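(* For all integers $n \geq 3$ and $k \geq 0$, \[ \mathscr{I}(C_n) \cong \begin{cases} K_3 & \text{if } n = 3,\\ 3K_1 & \text{if } n = 3k \geq 6,\\ \mathfrak{B}_k & \text{if } n = 3k+1,\\ C_n & \text{if } n \equiv 2 \pmod 3. \end{cases} \]
   Context: For a graph $G$, $i(G)$ is the minimum size of an independent dominating set, and an $i$-set of $G$ is an independent dominating set of size $i(G)$. The $i$-graph $\mathscr{I}(G)$ has the $i$-sets of $G$ as vertices, with $X,Y$ adjacent if and only if there is an edge $xy\in E(G)$ with $x\in X$, $y \notin X$ and $Y=(X\setminus\{x\})\cup\{y\}$. $C_n$ is the cycle on $n$ vertices and $3K_1$ is the edgeless graph on $3$ vertices. For $k \ge 1$, the bracelet graph $\mathfrak{B}_k$ is defined as follows, with all arithmetic modulo $3k+1$: its vertex set consists of all distinct $2$-subsets $\{j,\ell\}$ of $\{0,1,\dots,3k\}$ such that $\ell \equiv j+3s+2 \pmod{3k+1}$ for some $s \in \{0,1,\dots,k-1\}$; two vertices are adjacent if and only if they share one element and their other elements differ by $3$ modulo $3k+1$, i.e. the neighbours of $\{j,\ell\}$ are those of the pairs $\{j,\ell+3\},\{j,\ell-3\},\{j+3,\ell\},\{j-3,\ell\}$ that are vertices of $\mathfrak{B}_k$. (Equivalently, for $k \ge 2$: if $\ell - j \equiv 2$, the neighbours of $\{j,\ell\}$ are exactly $\{j,\ell+3\}$ and $\{j-3,\ell\}$; if $j-\ell\not\equiv \pm 2$, the neighbours are all four of the listed pairs.) *)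

(* Defs.v *)
From mathcomp Require Import all_boot.

Set Implicit Arguments.
Unset Strict Implicit.
Unset Printing Implicit Defensive.

Record sgraph := SGraph {
  vertex :> finType;
  adj : rel vertex;
  adj_sym : symmetric adj;
  adj_irr : irreflexive adj }.

Arguments adj {s} _ _ : rename.

Definition graph_iso (G H : sgraph) : Prop :=
  exists2 f : G -> H, bijective f & {mono f : x y / adj x y}.

Section IndependentDomination.
Variable G : sgraph.

Definition independent (X : {set G}) := [forall x in X, forall y in X, ~~ adj x y].

Definition dominating (X : {set G}) := [forall v, (v \in X) || [exists x in X, adj v x]].

Definition ind_dominating (X : {set G}) := independent X && dominating X.

(* A maximal independent set is dominating. *)
Lemma ind_dominating_card_ex :
  exists m, [exists X : {set G}, ind_dominating X && (#|X| == m)].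
Proof.
have ind0 : independent set0 by apply/forall_inP => x; rewrite inE.
have [X /maxsetP[indX maxX] _] := maxset_exists ind0.
exists #|X|; apply/existsP; exists X; rewrite eqxx andbT /ind_dominating indX.
apply/forallP => v; apply/orP; case: (boolP (v \in X)) => vX; [by left | right].
apply: contraT => /exists_inPn nvX; case/negP: vX.
suff indvX : independent (v |: X) by rewrite -(maxX _ indvX (subsetUr _ _)) setU11.
apply/forall_inP => x /setU1P[->|xX]; apply/forall_inP => y /setU1P[->|yX].
- by rewrite adj_irr.
- exact: nvX.
- by rewrite adj_sym nvX.
- by move/forall_inP: indX => /(_ x xX) /forall_inP /(_ y yX).
Qed.

Definition ind_dom_number : nat := ex_minn ind_dominating_card_ex.

Definition iset (X : {set G}) := ind_dominating X && (#|X| == ind_dom_number).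

Definition slide : rel {X : {set G} | iset X} := fun X Y =>
  [exists x, exists y, [&& adj x y, x \in val X, y \notin val X
                         & val Y == y |: (val X :\ x)]].

Lemma slide_sym : symmetric slide.
Proof.
suff imp X Y : slide X Y -> slide Y X by move=> X Y; apply/idP/idP; apply: imp.
case/existsP=> x /existsP[y /and4P[xy xX yX /eqP YE]].
have nxy : x != y by apply: contraNneq yX => <-.
apply/existsP; exists y; apply/existsP; exists x; rewrite adj_sym xy YE.
rewrite setU11 !inE eqxx (negbTE nxy) /= setU1K ?setD1K //.
by rewrite !inE negb_and yX orbT.
Qed.

Lemma slide_irr : irreflexive slide.
Proof.
move=> X; apply/existsP => -[x /existsP[y /and4P[_ _ yX /eqP XE]]].
by move: yX; rewrite XE setU11.
Qed.

Definition igraph : sgraph := SGraph slide_sym slide_irr.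

End IndependentDomination.

(* The condition [u != v] only matters for [n = 1]. *)
Definition cycle_rel n : rel 'I_n :=
  fun u v => (u != v) && ((v == ordS u) || (u == ordS v)).

Lemma cycle_sym n : symmetric (@cycle_rel n).
Proof. by move=> u v; rewrite /cycle_rel eq_sym orbC. Qed.

Lemma cycle_irr n : irreflexive (@cycle_rel n).
Proof. by move=> u; rewrite /cycle_rel eqxx. Qed.

Definition cycle_graph n : sgraph := SGraph (@cycle_sym n) (@cycle_irr n).

Definition complete_rel n : rel 'I_n := fun u v => u != v.

Lemma complete_sym n : symmetric (@complete_rel n).
Proof. by move=> u v; rewrite /complete_rel eq_sym. Qed.

Lemma complete_irr n : irreflexive (@complete_rel n).
Proof. by move=> u; rewrite /complete_rel eqxx. Qed.

Definition complete_graph n : sgraph :=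
  SGraph (@complete_sym n) (@complete_irr n).

Definition edgeless_rel n : rel 'I_n := fun _ _ => false.

Lemma edgeless_sym n : symmetric (@edgeless_rel n).
Proof. by []. Qed.

Lemma edgeless_irr n : irreflexive (@edgeless_rel n).
Proof. by []. Qed.

Definition edgeless_graph n : sgraph :=
  SGraph (@edgeless_sym n) (@edgeless_irr n).

Section Bracelet.
Variable k : nat.

Definition bracelet_pair (P : {set 'I_(3 * k + 1)}) : bool :=
  [exists j, exists l, exists s : 'I_k,
    [&& P == [set j; l], j != l & l == j + 3 * s + 2 %[mod 3 * k + 1]]].

Definition bracelet_rel : rel {P : {set 'I_(3 * k + 1)} | bracelet_pair P} :=
  fun P Q => [exists c, exists a, exists b,
    [&& val P :&: val Q == [set c], val P :\: val Q == [set a],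
        val Q :\: val P == [set b]
      & (b == a + 3 %[mod 3 * k + 1]) || (a == b + 3 %[mod 3 * k + 1])]].

Lemma bracelet_sym : symmetric bracelet_rel.
Proof.
suff imp P Q : bracelet_rel P Q -> bracelet_rel Q P.
  by move=> P Q; apply/idP/idP; apply: imp.
case/existsP=> c /existsP[a /existsP[b /and4P[PQ Pa Qb ab]]].
apply/existsP; exists c; apply/existsP; exists b; apply/existsP; exists a.
by rewrite setIC PQ Pa Qb orbC ab.
Qed.

Lemma bracelet_irr : irreflexive bracelet_rel.
Proof.
move=> P; apply/existsP => -[c /existsP[a /existsP[b /and4P[_ /eqP + _ _]]]].
by rewrite setDv => /setP/(_ a); rewrite !inE eqxx.
Qed.

Definition bracelet : sgraph := SGraph bracelet_sym bracelet_irr.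

End Bracelet.

(* Main.v *)
(** Write [x v] for the indicator of an independent dominating set [X] of [C_n].
    Each window of three consecutive vertices satisfies
    [x v + x (v+1) + x (v+2) = 1 + (v \in G)], where [G] is the set of left
    endpoints of the gaps of length 2 of [X].  Summing over [v] gives
    [3 |X| = n + |G|], so the i-sets are those with [|G| = 0, 1, 2] according
    to [n = 0, 2, 1] mod 3.  The window equation is a recurrence showing that a
    nonempty [G] determines [X], and that a slide by one vertex amounts to
    replacing one element [a] of [G] by [a + 3] or [a - 3].  Thus the i-graph
    is read off from the possible sets [G]: singletons with steps of [3] (a
    cycle, as 3 is coprime to [n]), or the pairs defining the bracelet. *)

Require Import Defs.
From mathcomp Require Import all_boot.
From mathcomp Require Import zify.

Set Implicit Arguments.
Unset Strict Implicit.
Unset Printing Implicit Defensive.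

(** Such a relation is the graph of a bijection, both directions being obtained by choice. Each case
    then only has to relate an i-set to its gap data. *)
Lemma graph_iso_rel (G H : sgraph) (R : G -> H -> bool) :
    (forall x, exists y, R x y) -> (forall y, exists x, R x y) ->
    (forall x x' y y', R x y -> R x' y' -> (x == x') = (y == y')) ->
    (forall x x' y y', R x y -> R x' y' -> adj x x' = adj y y') ->
  graph_iso G H.
Proof.
move=> totR surjR eqR adjR.
pose f x := xchoose (totR x); pose g y := xchoose (surjR y).
have fP x : R x (f x) := xchooseP (totR x).
have gP y : R (g y) y := xchooseP (surjR y).
exists f => [|x x']; last exact/esym/adjR.
exists g => x; apply/eqP.
  by rewrite (eqR _ _ _ _ (gP _) (fP _)).
by rewrite -(eqR _ _ _ _ (fP _) (gP _)).
Qed.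

(** * Short gaps and slides on a cycle *)

Section Cycle.
Variable n : nat.
Hypothesis n_gt2 : 2 < n.
Implicit Types (X Y : {set cycle_graph n}) (u v a : 'I_n).

Local Notation S := (@ordS n).

Lemma val_iter_ordS m v : iter m S v = (v + m) %% n :> nat.
Proof.
elim: m => [|m IHm] /=; first by rewrite addn0 modn_small.
by rewrite IHm -addn1 modnDml addn1 addnS.
Qed.

Lemma iter_ordS_mod m v : iter (m %% n) S v = iter m S v.
Proof. by apply: val_inj; rewrite /= !val_iter_ordS modnDmr. Qed.

Lemma eq_iter_ordS m m' v :
  (iter m S v == iter m' S v) = (m == m' %[mod n]).
Proof. by rewrite -val_eqE /= !val_iter_ordS eqn_modDl. Qed.

Lemma iter_ordS_neq m m' v :
  m < m' < m + n -> (iter m S v == iter m' S v) = false.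
Proof.
move=> /andP[lt_mm' lt_m'mn]; rewrite eq_iter_ordS eq_sym.
rewrite -(subnK (ltnW lt_mm')) -{3}[m]add0n eqn_modDr mod0n.
by rewrite modn_small; lia.
Qed.

Lemma exists_iter_ordS v u : exists2 m, m < n & u = iter m S v.
Proof.
exists ((u + (n - v)) %% n); first by rewrite ltn_mod; lia.
rewrite iter_ordS_mod; apply: val_inj; rewrite /= val_iter_ordS.
have lt_vn := ltn_ord v; have -> : v + (u + (n - v)) = u + n by lia.
by rewrite modnDr modn_small.
Qed.

Lemma ordS_pre u : exists v, u = S v.
Proof. by exists (ord_pred u); rewrite ord_predK. Qed.

Lemma adj_ordS v : @adj (cycle_graph n) v (S v).
Proof.
rewrite /= /cycle_rel eqxx /= andbT; apply/negbT.
by apply: (@iter_ordS_neq 0 1); lia.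
Qed.

(** Independence only concerns consecutive vertices, and domination of [S v] is a condition on the
    window starting at [v]; every vertex is such a successor. *)
Lemma ind_dominatingP X :
  reflect (forall v, ~~ ((v \in X) && (S v \in X)) /\
             [|| v \in X, S v \in X | S (S v) \in X])
          (ind_dominating X).
Proof.
apply: (iffP andP) => [[/forall_inP indX /forallP domX] v|locX].
  split.
    apply/andP => -[vX SvX].
    by have /forall_inP/(_ _ SvX) := indX _ vX; rewrite adj_ordS.
  have /orP[->|/exists_inP[u uX /andP[_ /orP[]/eqP Eu]]] := domX (S v).
  - by rewrite orbT.
  - by rewrite -Eu uX !orbT.
  - by move/ordS_inj: Eu => ->; rewrite uX.
split.
  apply/forall_inP => u uX; apply/forall_inP => v vX; apply/negP.
  case/andP=> _ /orP[]/eqP Ev.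
    by have [] := locX u; rewrite uX -Ev vX.
  by have [] := locX v; rewrite vX -Ev uX.
apply/forallP => v; have [u ->] := ordS_pre v.
have [_] := locX u; case: (S u \in X) => //=; rewrite orbC.
case/orP=> uX; apply/exists_inP.
  by exists (S (S u)) => //; apply: adj_ordS.
by exists u => //; apply: etrans (adj_ordS u); rewrite [RHS]adj_sym.
Qed.

Definition window X v : nat := (v \in X) + (S v \in X) + (S (S v) \in X).

(* On an independent dominating set the gap between consecutive members is 2
   or 3; [short_gaps] collects the left endpoints of the gaps of length 2. *)
Definition short_gaps X : {set 'I_n} :=
  [set v | (v \in X) && (S (S v) \in X)].

Lemma mem_short_gaps X v :
  (v \in short_gaps X) = (v \in X) && (S (S v) \in X).
Proof. by rewrite inE. Qed.

(** Domination puts at least one member in each window; independence allows a second only when the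
    two are its end vertices. *)
Lemma windowE X v :
  ind_dominating X -> window X v = (v \in short_gaps X).+1.
Proof.
move/ind_dominatingP => locX; rewrite mem_short_gaps /window.
have [] := locX v; have [] := locX (S v).
by case: (v \in X); case: (S v \in X); case: (S (S v) \in X).
Qed.

(** Double counting: each member is counted in three windows. *)
Lemma sum_window X : \sum_v window X v = 3 * #|X|.
Proof.
have sumS (F : 'I_n -> nat) : \sum_v F (S v) = \sum_v F v.
  by rewrite [RHS](reindex_inj (@ordS_inj n)).
rewrite /window !big_split /= (sumS (fun v => (S v \in X) : nat)).
rewrite (sumS (fun v => (v \in X) : nat)) !mulSn mul0n addn0 addnA.
suff -> : \sum_v (v \in X : nat) = #|X| by [].
by rewrite -sum1_card [RHS]big_mkcond; apply: eq_bigr => i _; case: (i \in X).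
Qed.

Lemma card_ind_dominating X :
  ind_dominating X -> 3 * #|X| = n + #|short_gaps X|.
Proof.
move=> idX; rewrite -sum_window.
under eq_bigr => v _ do rewrite windowE // -add1n.
rewrite big_split /= sum1_card card_ord; congr (_ + _).
rewrite -sum1_card [RHS]big_mkcond.
by apply: eq_bigr => i _; case: (i \in short_gaps X).
Qed.

(** The window value gives the third indicator from the first two, so the values at [v] and [S v]
    propagate around the cycle. *)
Lemma window_inj X Y v : window X =1 window Y ->
  (v \in X) = (v \in Y) -> (S v \in X) = (S v \in Y) -> X = Y.
Proof.
move=> eqw eqv eqSv; apply/setP => u; have [m _ ->] := exists_iter_ordS v u.
suff [] : (iter m S v \in X) = (iter m S v \in Y) /\
          (iter m.+1 S v \in X) = (iter m.+1 S v \in Y) by [].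
elim: m => // m [IH1 IH2]; split=> //; have := eqw (iter m S v).
rewrite /window IH1 [iter m.+1 _ _]/= in IH2 *; rewrite IH2.
by move/addnI => /=; case: (_ \in X); case: (_ \in Y).
Qed.

(** At a short gap [v] the indicators of [v] and [S v] are forced to be 1 and 0, which starts the
    recurrence of [window_inj]. *)
Lemma short_gaps_inj X Y : ind_dominating X -> ind_dominating Y ->
  short_gaps X = short_gaps Y -> short_gaps X != set0 -> X = Y.
Proof.
move=> idX idY eqG /set0Pn[v vP].
have eqw : window X =1 window Y by move=> u; rewrite !windowE ?eqG.
have /andP[vX SSvX] : (v \in X) && (S (S v) \in X) by rewrite -mem_short_gaps.
have /andP[vY SSvY] : (v \in Y) && (S (S v) \in Y).
  by rewrite -mem_short_gaps -eqG.
apply: (window_inj (v := v)) => //; first by rewrite vX vY.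
have := eqw v; rewrite /window vX vY SSvX SSvY.
by case: (S v \in X); case: (S v \in Y).
Qed.

(** By [card_ind_dominating] the number of short gaps is fixed modulo 3 by [n] and grows with the
    size of the set, so a value below 3 is the minimum. *)
Lemma isetE X0 X : ind_dominating X0 -> #|short_gaps X0| < 3 ->
  iset X = ind_dominating X && (#|short_gaps X| == #|short_gaps X0|).
Proof.
move=> idX0 ltX0; have cX0 := card_ind_dominating idX0; rewrite /iset.
have -> : ind_dom_number (cycle_graph n) = #|X0|.
  rewrite /ind_dom_number; case: ex_minnP => m /existsP[X1 /andP[idX1 /eqP cX1]].
  have cardX1 := card_ind_dominating idX1.
  move=> /(_ #|X0|) minm.
  have le_m : m <= #|X0| by apply: minm; apply/existsP; exists X0; rewrite idX0 /=.
  lia.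
have [idX|//] := boolP (ind_dominating X); rewrite !andTb.
by have cX := card_ind_dominating idX; apply/eqP/eqP; lia.
Qed.

(** [g] prescribes the members and [D] the short gaps by offset from [v]. Wrapping around is
    expressed by tests rather than modulo [n], which keeps the obligations in linear arithmetic. *)
Lemma ind_dominating_of_pattern v (g D : nat -> bool) :
    (forall e, e < n ->
      let e1 := if e.+1 == n then 0 else e.+1 in
      let e2 := if e1.+1 == n then 0 else e1.+1 in
      ~~ (g e && g e1) /\ g e + g e1 + g e2 = (D e).+1) ->
  exists X, [/\ ind_dominating X,
    forall e, e < n -> (iter e S v \in X) = g e
    & forall e, e < n -> (iter e S v \in short_gaps X) = D e].
Proof.
move=> locg.
pose X := [set iter e S v | e : 'I_n & g e] : {set cycle_graph n}.
have memX e : e < n -> (iter e S v \in X) = g e.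
  move=> lt_en; apply/imsetP/idP => [[e' ge' /eqP]|ge].
    rewrite inE in ge'; rewrite eq_iter_ordS !modn_small // => /eqP Ee.
    by rewrite Ee.
  by exists (Ordinal lt_en) => //; rewrite inE.
have iterS e : e < n -> let e1 := if e.+1 == n then 0 else e.+1 in
    e1 < n /\ S (iter e S v) = iter e1 S v.
  move=> lt_en; case: eqP => /= [En|nEn]; last by split=> //; lia.
  split; first lia.
  by rewrite -[S _]/(iter e.+1 S v) En -iter_ordS_mod modnn.
have windowX e : e < n ->
    ~~ ((iter e S v \in X) && (S (iter e S v) \in X)) /\
    (iter e S v \in X) + (S (iter e S v) \in X) + (S (S (iter e S v)) \in X)
      = (D e).+1.
  move=> lt_en; have [] := locg e lt_en; have [lt1 E1] := iterS e lt_en.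
  have [lt2 E2] := iterS _ lt1.
  by rewrite E1 E2 !memX.
have idX : ind_dominating X.
  apply/ind_dominatingP => u; have [e lt_en ->] := exists_iter_ordS v u.
  have [indg wg] := windowX e lt_en; split=> //; move: wg.
  by do 3!case: (_ \in X).
exists X; split=> // e lt_en; have [_] := windowX e lt_en.
rewrite -/(window X (iter e S v)) windowE // => -[].
by case: (_ \in short_gaps X); case: (D e).
Qed.

(* [Q] arises from [P] by replacing [a] with [a + 3], stated as an equation of
   indicators so that it can be compared with [windowE]. *)
Definition moves_gap (P Q : {set 'I_n}) a :=
  forall v, (v \in Q) + (v == a) = (v \in P) + (v == S (S (S a))) :> nat.

(** The windows containing [S (S a)] start at [a], [S a], [S (S a)], and those containing the next
    vertex one step later; the common ones cancel. *)
Lemma window_move X Y a :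
    (forall v, (v \in Y) + (v == S (S a)) = (v \in X) + (v == S (S (S a)))) ->
  forall v, window Y v + (v == a) = window X v + (v == S (S (S a))).
Proof.
move=> eqXY v; have := eqXY v; have := eqXY (S v); have := eqXY (S (S v)).
rewrite !(inj_eq (@ordS_inj n)) /window; lia.
Qed.

Lemma mem_move X x y v : x \in X -> y \notin X ->
  (v \in y |: (X :\ x)) + (v == x) = (v \in X) + (v == y).
Proof.
move=> xX yX; rewrite !inE; case: (v =P y) => [->|_].
  by rewrite (negbTE yX); case: (y =P x) yX => // ->; rewrite xX.
by case: (v =P x) => [->|_] /=; rewrite ?xX ?addn0.
Qed.

(** Pushing [x] forward lowers the window starting two places before [x] and raises the one starting
    at [S x]; so [x] is [S (S a)] for the gap [a] that moves. *)
Lemma moves_gapP X Y : 3 < n -> ind_dominating X -> ind_dominating Y ->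
  (exists x, [/\ x \in X, S x \notin X & Y = S x |: (X :\ x)]) <->
  (exists a, moves_gap (short_gaps X) (short_gaps Y) a).
Proof.
move=> n_gt3 idX idY.
split=> [[x [xX SxX EY]]|[a mva]].
  have [b Ex] := ordS_pre x; have [a Eb] := ordS_pre b.
  exists a => v; subst b x.
  have /window_move/(_ v) : forall v,
      (v \in Y) + (v == S (S a)) = (v \in X) + (v == S (S (S a))).
    by move=> u; rewrite EY mem_move.
  by rewrite !windowE // !addSn => -[].
have neq m m' : m < m' < m + 4 -> (iter m S a == iter m' S a) = false.
  by move=> lt_m; apply: iter_ordS_neq; lia.
have locX v : ~~ ((v \in X) && (S v \in X)) by have /ind_dominatingP/(_ v)[] := idX.
have locY v : ~~ ((v \in Y) && (S v \in Y)) by have /ind_dominatingP/(_ v)[] := idY.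
have := mva a; have := mva (S (S (S a))); have := mva (S (S a)).
have /= := (neq 0 3 erefl); have /= := (neq 2 3 erefl).
have /= := (neq 0 2 erefl).
rewrite [S (S (S a)) == a]eq_sym [S (S a) == a]eq_sym !eqxx.
move=> neq02 neq23 neq03; rewrite neq02 neq23 neq03.
rewrite !mem_short_gaps => mv2 mv3 mv0.
(* The move, evaluated at [a] and at [S (S (S a))], makes the former a short gap of [X] and the
   latter one of [Y]. *)
have [aX SSaX] : a \in X /\ S (S a) \in X.
  by move: mv0; do 2!case: (_ \in Y); do 2!case: (_ \in X).
have [Y3 Y5] : S (S (S a)) \in Y /\ S (S (S (S (S a)))) \in Y.
  by move: mv3; do 2!case: (_ \in Y); do 2!case: (_ \in X).
have X3 : S (S (S a)) \notin X by have := locX (S (S a)); rewrite SSaX.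
exists (S (S a)); split=> //.
have Y2 : S (S a) \notin Y.
  by have := locY (S (S a)); rewrite Y3 andbT.
(* Otherwise [S (S a)] would be a short gap of [X], hence of [Y] since the move leaves it alone,
   although [Y] omits it. *)
have X4 : S (S (S (S a))) \notin X.
  by move: mv2; rewrite SSaX (negbTE Y2); case: (_ \in X).
have Y4 : S (S (S (S a))) \notin Y.
  by have := locY (S (S (S a))); rewrite Y3.
(* [Y] and the slid set have equal windows and agree at two consecutive vertices. *)
apply: (window_inj (v := S (S (S a)))).
- move=> v; have /window_move/(_ v) : forall v,
      (v \in S (S (S a)) |: (X :\ S (S a))) + (v == S (S a))
       = (v \in X) + (v == S (S (S a))) by move=> u; rewrite mem_move.
  rewrite (windowE _ idX) (windowE _ idY) // addSn -mva -addSn.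
  by move/addIn.
- by rewrite Y3 setU11.
rewrite (negbTE Y4) !inE (negbTE X4) andbF orbF eq_sym.
exact/esym/(neq 3 4).
Qed.

(** A backward slide from [X] to [Y] is a forward slide from [Y] to [X], so only forward slides need
    analysis. *)
Lemma slideP (X Y : igraph (cycle_graph n)) :
  reflect ((exists x, [/\ x \in val X, S x \notin val X
                        & val Y = S x |: (val X :\ x)]) \/
           (exists x, [/\ x \in val Y, S x \notin val Y
                        & val X = S x |: (val Y :\ x)]))
          (adj X Y).
Proof.
have slideS (A B : igraph (cycle_graph n)) x :
    x \in val A -> S x \notin val A -> val B = S x |: (val A :\ x) -> adj A B.
  move=> xA SxA EB; apply/existsP; exists x; apply/existsP; exists (S x).
  by rewrite adj_ordS xA SxA EB eqxx.
apply: (iffP idP) => [|[[x [? ? ?]]|[x [? ? ?]]]]; last first.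
- by rewrite adj_sym; apply: slideS; eassumption.
- by apply: slideS; eassumption.
case/existsP=> x /existsP[y /and4P[/andP[nxy xy] xX yX /eqP EY]].
case/orP: xy => /eqP E; first by left; exists x; rewrite -E.
right; exists y; rewrite -E EY setU11; split=> //.
  by rewrite !inE eqxx (negbTE nxy).
by rewrite setU1K ?setD1K // !inE negb_and yX orbT.
Qed.

Lemma adj_igraphP (X Y : igraph (cycle_graph n)) : 3 < n ->
  reflect ((exists a, moves_gap (short_gaps (val X)) (short_gaps (val Y)) a) \/
           (exists a, moves_gap (short_gaps (val Y)) (short_gaps (val X)) a))
          (adj X Y).
Proof.
move=> n_gt3; have /andP[idX _] := valP X; have /andP[idY _] := valP Y.
have PXY := moves_gapP n_gt3 idX idY; have PYX := moves_gapP n_gt3 idY idX.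
by apply: (iffP (slideP X Y)); tauto.
Qed.


(** Links the indicator equation to the set differences used in [bracelet_rel]; [3 < n] keeps [a]
    and [S (S (S a))] distinct. *)
Lemma moves_gapE (P Q : {set 'I_n}) a : 3 < n ->
  moves_gap P Q a <-> P :\: Q = [set a] /\ Q :\: P = [set S (S (S a))].
Proof.
move=> n_gt3; have neq03 : (a == S (S (S a))) = false.
  by apply: (@iter_ordS_neq 0 3); lia.
split=> [mva|[/setP PQ /setP QP] v].
  split; apply/setP => v; have := mva v; rewrite !inE.
    have [->|_] := eqVneq v a; rewrite ?neq03;
    by do ![case: (_ \in _) | case: (_ == _)].
  have [->|_] := eqVneq v (S (S (S a))); rewrite 1?[_ == a]eq_sym ?neq03;
  by do ![case: (_ \in _) | case: (_ == _)].
have := PQ v; have := QP v; rewrite !inE => <- <-.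
by case: (v \in P); case: (v \in Q).
Qed.

Lemma mod_add3E (a b : 'I_n) : (b == a + 3 %[mod n]) = (b == S (S (S a))).
Proof. by rewrite -[RHS]val_eqE [val (S _)](val_iter_ordS 3) modn_small. Qed.

End Cycle.

(** * Case [n = 3k + 2]: one short gap *)

Section Residue2.
Variables (n k : nat).
Hypotheses (n_gt2 : 2 < n) (En : n = 3 * k + 2).
Local Notation S := (@ordS n).

Lemma short_gaps1_ex v :
  exists2 X : {set cycle_graph n}, ind_dominating X & short_gaps X = [set v].
Proof.
(* Members at offsets 0, 2, 5, ..., n - 3: one gap of length 2, then only gaps of length 3. *)
pose g e := (e == 0) || (e %% 3 == 2).
have [e lt_en /=|X [idX _ gapX]] :=
  @ind_dominating_of_pattern n n_gt2 v g (fun e => e == 0).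
  rewrite /g; have [Ee|nEe] := eqVneq e.+1 n.
    by have [En1|nEn1] := eqVneq 1 n; [lia | split; lia].
  by have [Ee1|nEe1] := eqVneq e.+2 n; split; lia.
exists X => //; apply/setP => u; have [e lt_en ->] := exists_iter_ordS n_gt2 v u.
rewrite gapX // inE -[RHS]/(iter e S v == iter 0 S v) eq_iter_ordS.
by rewrite !modn_small //; lia.
Qed.

Lemma iset_residue2 (X : {set cycle_graph n}) :
  iset X = ind_dominating X && (#|short_gaps X| == 1).
Proof.
have [X0 idX0 gapX0] := short_gaps1_ex (Ordinal (ltnW (ltnW n_gt2))).
by rewrite (isetE n_gt2 _ idX0) gapX0 cards1.
Qed.

Lemma coprime3 : coprime 3 n.
Proof. by rewrite En prime_coprime // /dvdn; lia. Qed.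

Lemma igraph_residue2 : graph_iso (igraph (cycle_graph n)) (cycle_graph n).
Proof.
have n_gt3 : 3 < n by lia.
pose v0 := Ordinal (ltnW (ltnW n_gt2)).
(* Labelling the vertex [3 t] by [t] is bijective, 3 being coprime to [n], and turns gap moves by 3
   into steps along the cycle. *)
pose mul3 (t : 'I_n) := iter (3 * t) S v0.
have mul3_inj : injective mul3.
  move=> t u /eqP; rewrite eq_iter_ordS => /eqP E; apply: val_inj.
  wlog le_tu : t u E / t <= u.
    by move=> H; case: (leqP t u) => [/H->|/ltnW/H->].
  have /eqP : 3 * u = 3 * t %[mod n] by [].
  rewrite eqn_mod_dvd ?leq_pmul2l // -mulnBr Gauss_dvdr; last first.
    by rewrite coprime_sym coprime3.
  have := ltn_ord u; have [//|] := posnP (u - t); first by rewrite /=; lia.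
  by move=> lt0 ltu /dvdn_leq -/(_ lt0); lia.
have mul3S t : mul3 (S t) = S (S (S (mul3 t))).
  rewrite -[RHS]/(iter (3 + 3 * t) S v0); apply/eqP.
  by rewrite eq_iter_ordS /= modnMmr mulnS.
pose R (X : igraph (cycle_graph n)) (t : cycle_graph n) :=
  short_gaps (val X) == [set mul3 t].
apply: (@graph_iso_rel _ _ R).
- move=> X; have := valP X; rewrite iset_residue2 => /andP[_ /cards1P[u Eu]].
  have [f _ fK] := injF_bij mul3_inj.
  by exists (f u); rewrite /R Eu fK.
- move=> t; have [X idX gapX] := short_gaps1_ex (mul3 t).
  have isX : iset X by rewrite iset_residue2 idX gapX cards1.
  by exists (Sub X isX); rewrite /R gapX.
- move=> X Y t u /eqP EX /eqP EY; apply/eqP/eqP => [E|E].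
    by apply/mul3_inj/set1_inj; rewrite -EX -EY E.
  have /andP[idX _] := valP X; have /andP[idY _] := valP Y.
  apply/val_inj/(short_gaps_inj n_gt2); rewrite ?EX ?EY ?E //.
  by apply/set0Pn; exists (mul3 u); rewrite set11.
move=> X Y t u /eqP EX /eqP EY.
have movesE (p q : 'I_n) :
    (exists a, moves_gap [set mul3 p] [set mul3 q] a) <-> q = S p.
  split=> [[a /(moves_gapE n_gt2 _ _ _ n_gt3)[/setP Pa /setP Qa]]|->].
    apply: mul3_inj; rewrite mul3S.
    have := Pa a; have := Qa (S (S (S a))).
    by rewrite !inE !eqxx => /andP[_ /eqP<-] /andP[_ /eqP<-].
  by exists (mul3 p) => v; rewrite !inE mul3S addnC.
apply/(adj_igraphP n_gt2)/idP => //; rewrite EX EY.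
  move=> [/movesE->|/movesE->]; first exact: adj_ordS.
  by rewrite adj_sym; apply: adj_ordS.
by case/andP=> _ /orP[]/eqP E; [left | right]; apply/movesE.
Qed.

End Residue2.

(** * Case [n = 3k + 1]: two short gaps *)

Section Residue1.
Variable k : nat.
Hypothesis k_gt0 : 0 < k.
Let n := 3 * k + 1.
Local Notation S := (@ordS n).

Let n_gt3 : 3 < n. Proof. by rewrite /n; lia. Qed.
Let n_gt2 : 2 < n := ltnW n_gt3.

Lemma short_gaps2_ex v s : s < k ->
  exists2 X : {set cycle_graph n}, ind_dominating X &
    short_gaps X = [set v; iter (3 * s + 2) S v].
Proof.
move=> lt_sk.
(* Members at offsets 0, 2, 5, ..., 3s + 2, then 3s + 4, 3s + 7, ... (none if [s = k - 1]): the gaps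
   at 0 and 3s + 2 have length 2, all others 3. *)
pose g e := [|| e == 0, (e <= 3 * s + 2) && (e %% 3 == 2)
              | (3 * s + 2 < e) && (e %% 3 == 1)].
have [e lt_en /=|X [idX _ gapX]] :=
  @ind_dominating_of_pattern n n_gt2 v g
    (fun e => (e == 0) || (e == 3 * s + 2)).
  rewrite /g /n in lt_en *; have [Ee|nEe] := eqVneq e.+1 (3 * k + 1).
    by have [En1|nEn1] := eqVneq 1 (3 * k + 1); [lia | split; lia].
  by have [Ee1|nEe1] := eqVneq e.+2 (3 * k + 1); split; lia.
exists X => //; apply/setP => u; have [e lt_en ->] := exists_iter_ordS n_gt2 v u.
rewrite gapX // !inE -[iter e S v == v]/(iter e S v == iter 0 S v) !eq_iter_ordS.
by rewrite !modn_small // /n; lia.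
Qed.

Lemma iset_residue1 (X : {set cycle_graph n}) :
  iset X = ind_dominating X && (#|short_gaps X| == 2).
Proof.
have [X0 idX0 gapX0] := short_gaps2_ex (Ordinal (ltnW (ltnW n_gt2))) k_gt0.
have card2 : #|short_gaps X0| = 2.
  rewrite gapX0 cards2 (_ : _ != _) //; apply/negbT.
  exact: (@iter_ordS_neq n n_gt2 0 2).
by rewrite (isetE n_gt2 _ idX0) card2.
Qed.

(** The walk from one short gap [j] to the other, [l], takes one gap of length 2 and then gaps of
    length 3, so its length is 2 modulo 3. *)
Lemma bracelet_short_gaps (X : {set cycle_graph n}) :
  ind_dominating X -> #|short_gaps X| == 2 -> @bracelet_pair k (short_gaps X).
Proof.
move=> idX /cards2P[j [l [njl gapX]]].
have [d lt_dn El] := exists_iter_ordS n_gt2 j l.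
have d_gt0 : 0 < d by case: d El lt_dn njl => // ->; rewrite eqxx.
have jgap : j \in short_gaps X by rewrite gapX !inE eqxx.
have lgap : l \in short_gaps X by rewrite gapX !inE eqxx orbT.
move: jgap lgap; rewrite !mem_short_gaps => /andP[jX SSjX] /andP[lX _].
(* Between the two short gaps all gaps have length 3. *)
have memX e : e < d ->
    (iter e.+1 S j \in X) = (e.+1 %% 3 == 2) /\
    (iter e.+2 S j \in X) = (e.+2 %% 3 == 2).
  elim: e => [|e IHe] lt_ed /=.
    have /(ind_dominatingP n_gt2)/(_ j)[] := idX; rewrite jX SSjX /=.
    by move/negbTE->.
  have [IH1 IH2] := IHe (ltnW lt_ed); split=> //.
  have := windowE n_gt2 (iter e.+1 S j) idX.
  have -> : (iter e.+1 S j \in short_gaps X) = false.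
    rewrite gapX !inE El -[_ == j]/(iter e.+1 S j == iter 0 S j) !eq_iter_ordS.
    by rewrite !modn_small; lia.
  rewrite /window IH1 -[S (iter e.+1 S j)]/(iter e.+2 S j) IH2.
  by rewrite -[S (iter e.+2 S j)]/(iter e.+3 S j) /=; case: (_ \in X); lia.
have [] := memX d.-1; first lia.
rewrite prednK // -El lX => /esym/eqP d3 _.
have lt_sk : d %/ 3 < k by move: lt_dn; rewrite /n; lia.
apply/existsP; exists j; apply/existsP; exists l.
apply/existsP; exists (Ordinal lt_sk); rewrite gapX eqxx njl El /=.
have -> : j + 3 * (d %/ 3) + 2 = j + d by lia.
by rewrite val_iter_ordS modn_mod.
Qed.

Lemma bracelet_relE (X Y : igraph (cycle_graph n)) (P Q : bracelet k) :
    short_gaps (val X) = val P -> short_gaps (val Y) = val Q ->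
  adj X Y = adj P Q.
Proof.
move=> EX EY.
have gap2 (Z : igraph (cycle_graph n)) : #|short_gaps (val Z)| = 2.
  by have := valP Z; rewrite iset_residue1 => /andP[_ /eqP].
have card2 : #|val P| = 2 /\ #|val Q| = 2 by rewrite -EX -EY !gap2.
(* The common element demanded by [bracelet_rel] comes for free: a pair losing one element keeps the
   other. *)
have meet1 (A B : {set 'I_n}) a :
    #|A| = 2 -> A :\: B = [set a] -> exists c, A :&: B = [set c].
  move=> A2 Ba; apply/cards1P/eqP.
  by have := cardsID B A; rewrite A2 Ba cards1; lia.
apply/(adj_igraphP n_gt2)/existsP => //; rewrite EX EY.
  case=> -[a /(moves_gapE n_gt2 _ _ _ n_gt3)[PQ QP]].
    have [c PQc] := meet1 _ _ _ card2.1 PQ.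
    exists c; apply/existsP; exists a; apply/existsP; exists (S (S (S a))).
    by rewrite PQc PQ QP !eqxx (mod_add3E a) eqxx.
  have [c PQc] := meet1 _ _ _ card2.2 PQ.
  exists c; apply/existsP; exists (S (S (S a))); apply/existsP; exists a.
  by rewrite setIC PQc PQ QP !eqxx (mod_add3E a (S (S (S a)))) eqxx orbT.
case=> c /existsP[a /existsP[b /and4P[_ /eqP PQ /eqP QP]]].
rewrite !(mod_add3E (n := n)) => /orP[]/eqP E; [left; exists a | right; exists b];
by apply/(moves_gapE n_gt2 _ _ _ n_gt3); rewrite -E.
Qed.

Lemma igraph_residue1 : graph_iso (igraph (cycle_graph n)) (bracelet k).
Proof.
pose R (X : igraph (cycle_graph n)) (Q : bracelet k) :=
  short_gaps (val X) == val Q.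
apply: (@graph_iso_rel _ _ R).
- move=> X; have := valP X; rewrite iset_residue1 => /andP[idX c2].
  by exists (Sub (short_gaps (val X)) (bracelet_short_gaps idX c2)); rewrite /R /=.
- case=> Q brQ /=.
  have /existsP[j /existsP[l /existsP[s /and3P[/eqP EQ njl /eqP El]]]] := brQ.
  have [X idX gapX] := short_gaps2_ex j (ltn_ord s).
  have gapQ : short_gaps X = Q.
    rewrite gapX EQ; congr [set _; _]; apply: val_inj.
    by rewrite /= val_iter_ordS addnA -El modn_small.
  have isX : iset X by rewrite iset_residue1 idX gapQ EQ cards2 njl.
  by exists (Sub X isX); rewrite /R /= gapQ.
- move=> X Y P Q /eqP EX /eqP EY; rewrite -[RHS]val_eqE -EX -EY.
  apply/eqP/eqP => [->//|E].
  have := valP X; rewrite iset_residue1 => /andP[idX /eqP c2].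
  have := valP Y; rewrite iset_residue1 => /andP[idY _].
  by apply/val_inj/(short_gaps_inj n_gt2); rewrite -?card_gt0 ?c2.
by move=> X Y P Q /eqP EX /eqP EY; apply: bracelet_relE.
Qed.

End Residue1.

(** * Case [n = 3k]: no short gap *)

Section Residue0.
Variables n k : nat.
Hypotheses (n_gt2 : 2 < n) (En : n = 3 * k).
Local Notation S := (@ordS n).

Let v0 : 'I_n := Ordinal (ltnW (ltnW n_gt2)).

Lemma short_gaps0_ex c : c < 3 ->
  exists X : {set cycle_graph n},
    [/\ ind_dominating X, short_gaps X = set0 & iter c S v0 \in X].
Proof.
(* A residue class modulo 3: all gaps have length 3. *)
move=> lt_c3; pose g e := e %% 3 == c.
have [e lt_en /=|X [idX memX gapX]] :=
  @ind_dominating_of_pattern n n_gt2 v0 g (fun=> false).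
  rewrite /g; have [Ee|nEe] := eqVneq e.+1 n.
    by have [En1|nEn1] := eqVneq 1 n; [lia | split; lia].
  by have [Ee1|nEe1] := eqVneq e.+2 n; split; lia.
exists X; split=> //; last by rewrite memX /g ?modn_small //; lia.
apply/setP => u; have [e lt_en ->] := exists_iter_ordS n_gt2 v0 u.
by rewrite gapX // inE.
Qed.

Lemma iset_residue0 (X : {set cycle_graph n}) :
  iset X = ind_dominating X && (short_gaps X == set0).
Proof.
have [X0 [idX0 gapX0 _]] := short_gaps0_ex (isT : 0 < 3).
by rewrite (isetE n_gt2 _ idX0) gapX0 cards0 // cards_eq0.
Qed.

Lemma window_residue0 (X : igraph (cycle_graph n)) v : window (val X) v = 1.
Proof.
have := valP X; rewrite iset_residue0 => /andP[idX /eqP gapX].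
by rewrite windowE // gapX inE.
Qed.

(** All windows equal 1, so an i-set contains exactly one of the first three vertices and is
    determined by it. A general [H] serves both the edgeless graph and the triangle. *)
Lemma igraph_residue0 (H : sgraph) (f : 'I_3 -> H) : bijective f ->
    (forall (X Y : igraph (cycle_graph n)) (c d : 'I_3),
       iter c S v0 \in val X -> iter d S v0 \in val Y ->
       adj X Y = adj (f c) (f d)) ->
  graph_iso (igraph (cycle_graph n)) H.
Proof.
move=> [g fK gK] adjf.
have memE (X : igraph (cycle_graph n)) (c : 'I_3) : iter c S v0 \in val X ->
    forall d : 'I_3, (iter d S v0 \in val X) = (d == c).
  have := window_residue0 X v0; rewrite /window.
  case: c => [[|[|[|//]]] ?] /= w cX [[|[|[|//]]] ?];
  move: w cX; rewrite -val_eqE /=;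
  by do 3!case: (_ \in val X).
pose R (X : igraph (cycle_graph n)) (y : H) := iter (g y) S v0 \in val X.
apply: (@graph_iso_rel _ _ R).
- move=> X; suff [c cX] : exists c : 'I_3, iter c S v0 \in val X.
    by exists (f c); rewrite /R fK.
  have := window_residue0 X v0; rewrite /window.
  case X0: (v0 \in val X); first by exists (inord 0); rewrite inordK.
  case X1: (S v0 \in val X); first by exists (inord 1); rewrite inordK.
  case X2: (S (S v0) \in val X); first by exists (inord 2); rewrite inordK.
  by [].
- move=> y; have [X [idX gapX yX]] := short_gaps0_ex (ltn_ord (g y)).
  have isX : iset X by rewrite iset_residue0 idX gapX eqxx.
  by exists (Sub X isX).
- move=> X Y y z yX zY; rewrite -(can_eq gK); apply/eqP/eqP => [EXY|Eyz].
    by apply/eqP; rewrite eq_sym -(memE X) // EXY.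
  rewrite /R Eyz in yX zY; apply/val_inj/(window_inj n_gt2 (v := v0)).
  + by move=> v; rewrite !window_residue0.
  + by rewrite (memE _ _ yX ord0) (memE _ _ zY ord0).
  + by have := memE _ _ yX (inord 1); rewrite -(memE _ _ zY) inordK.
move=> X Y y z yX zY; rewrite (adjf _ _ _ _ yX zY).
by rewrite !gK.
Qed.

(** There is no short gap to move, hence no edge. *)
Lemma igraph_residue0_edgeless : 3 < n ->
  graph_iso (igraph (cycle_graph n)) (edgeless_graph 3).
Proof.
move=> n_gt3; apply: (@igraph_residue0 (edgeless_graph 3) id); first by exists id.
move=> X Y c d _ _; apply/(adj_igraphP n_gt2) => //.
have := valP X; rewrite iset_residue0 => /andP[_ /eqP->].
have := valP Y; rewrite iset_residue0 => /andP[_ /eqP->].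
by case=> -[a /(moves_gapE n_gt2 _ _ _ n_gt3)[/setP/(_ a)]]; rewrite !inE eqxx.
Qed.

End Residue0.

(** For [n = 3] a move by 3 is trivial and the gap criterion does not apply. The i-sets are
    singletons, and any two distinct vertices of the triangle are adjacent. *)
Lemma igraph_cycle3 : graph_iso (igraph (cycle_graph 3)) (complete_graph 3).
Proof.
apply: (@igraph_residue0 3 1 isT erefl (complete_graph 3) id); first by exists id.
move=> X Y c d; set v0 := Ordinal _.
have iterE (e : 'I_3) : iter e (@ordS 3) v0 = e.
  by apply: val_inj; rewrite [LHS]val_iter_ordS [v0 + e]add0n modn_small.
rewrite !iterE => cX dY.
have sing (Z : igraph (cycle_graph 3)) (e : 'I_3) :
    e \in val Z -> val Z = [set e].
  move=> eZ; have := valP Z.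
  rewrite (iset_residue0 (k := 1)) // => /andP[idZ /eqP gapZ].
  have /eqP/cards1P[u Eu] : #|val Z| = 1.
    by have := card_ind_dominating (isT : 2 < 3) idZ; rewrite gapZ cards0; lia.
  by move: eZ; rewrite Eu inE => /eqP->.
rewrite /= /slide /complete_rel (sing X c) // (sing Y d) //.
apply/existsP/idP => [[x /existsP[y /and4P[_ ]]]|ncd].
  rewrite !inE => /eqP-> nyc; rewrite setDv setU0 => /eqP/set1_inj->.
  by rewrite eq_sym.
exists c; apply/existsP; exists d.
rewrite !inE eqxx setDv setU0 eqxx [d == c]eq_sym /= /cycle_rel ncd /= andbT.
by case: c d ncd {cX dY} => [[|[|[|//]]] ?] [[|[|[|//]]] ?].
Qed.

Theorem mainTheorem2 (n k : nat) (hn : 3 <= n) :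
  [/\ n = 3 -> graph_iso (igraph (cycle_graph n)) (complete_graph 3),
      n = 3 * k -> 6 <= n ->
        graph_iso (igraph (cycle_graph n)) (edgeless_graph 3),
      n = 3 * k + 1 -> graph_iso (igraph (cycle_graph n)) (bracelet k)
    & n = 2 %[mod 3] -> graph_iso (igraph (cycle_graph n)) (cycle_graph n)].
Proof.
split=> [->|En n_ge6|En|En].
- exact: igraph_cycle3.
- by apply: (igraph_residue0_edgeless hn En); lia.
- by rewrite En; apply: igraph_residue1; lia.
by apply: (@igraph_residue2 n (n %/ 3)) => //; lia.
Qed.
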